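(* Let $c\ge3$ be a constant and let $\sigma\in\Sigma$ satisfy $\sigma(i,n-i)\in\{0,1\}$ for every $n\ge2$ and $1\le i\le n-1$, and $\sum_{\frac nc\le k\le n-\frac nc}\sigma(k,n-k)\ge1$ for every $n\ge2$ (i.e., the unique $k(n)$ with $\sigma(k(n),n-k(n))=1$ satisfies $n/c\le k(n)\le n-n/c$). Then $\mathcal{D}_\sigma(n)\in\mathcal{O}(\sqrt n)$.
   Context: Binary trees are terms over a leaf symbol $a$ and a binary symbol $f$: $a$ is a binary tree, and if $t_1,t_2$ are binary trees then so is $f(t_1,t_2)$. $|t|$ is the number of leaves of $t$, $\mathcal{T}_n$ the set of binary trees with $n$ leaves. $|\mathcal{D}_t|$ (the size of the minimal DAG of $t$) is the number of pairwise non-isomorphic subtrees of $t$. $\Sigma$ is the set of functions $\sigma:(\mathbb{N}\setminus\{0\})^2\to[0,1]$ with $\sum_{i,j\ge1,\, i+j=k}\sigma(i,j)=1$ for every integer $k\ge2$. For $\sigma\in\Sigma$, $P_\sigma(a)=1$ and $P_\sigma(f(u,v))=\sigma(|u|,|v|)P_\sigma(u)P_\sigma(v)$, and $\mathcal{D}_\sigma(n)=\sum_{t\in\mathcal{T}_n}P_\sigma(t)|\mathcal{D}_t|$. A sum $\sum_{q_0\le k\le q_1}$ with rational bounds ranges over integers $k$ from $\lceil q_0\rceil$ to $\lfloor q_1\rfloor$. *)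

(* Defs.v *)
From HB Require Import structures.
From mathcomp Require Import all_boot all_order all_algebra.
From mathcomp Require Import all_classical all_reals all_analysis.

Set Implicit Arguments.
Unset Strict Implicit.
Unset Printing Implicit Defensive.

Import Order.TTheory GRing.Theory Num.Theory.
Import numFieldNormedType.Exports.

Local Open Scope classical_set_scope.
Local Open Scope ring_scope.

Inductive btree : Type := Leaf | Node of btree & btree.

Fixpoint btree_encode (t : btree) : GenTree.tree unit :=
  match t with
  | Leaf => GenTree.Leaf tt
  | Node u v => GenTree.Node 0 [:: btree_encode u; btree_encode v]
  end.

Fixpoint btree_decode (g : GenTree.tree unit) : btree :=
  match g with
  | GenTree.Node _ [:: u; v] => Node (btree_decode u) (btree_decode v)
  | _ => Leaf
  end.

Lemma btree_encodeK : cancel btree_encode btree_decode.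
Proof. by elim=> [|u IHu v IHv] //=; rewrite IHu IHv. Qed.

HB.instance Definition _ := Countable.copy btree (can_type btree_encodeK).

Fixpoint nleaves (t : btree) : nat :=
  match t with
  | Leaf => 1
  | Node u v => nleaves u + nleaves v
  end.

Definition trees (n : nat) : set btree := [set t | nleaves t = n].

Lemma nleaves_gt0 (t : btree) : (0 < nleaves t)%N.
Proof. by elim: t => [|u IHu v _] //=; rewrite addn_gt0 IHu. Qed.

(* Needed for sums of the form \sum_(t \in trees n): they default to 0 on
   infinite supports. *)
Lemma finite_trees (n : nat) : finite_set (trees n).
Proof.
suff fin : finite_set [set t | (nleaves t <= n)%N].
  by apply: sub_finite_set fin => t /= ->.
elim: n => [|n IHn].
  apply: (@sub_finite_set _ _ set0) => // t /=.
  by rewrite leqNgt nleaves_gt0.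
pose A := [set t | (nleaves t <= n)%N].
apply: (@sub_finite_set _ _
  ([set Leaf] `|` [set Node u v | u in A & v in A])).
  case=> [|u v] /= h; [by left | right].
  exists u; [|exists v => //]; rewrite /A/= -ltnS; apply: leq_trans h.
    by rewrite -addn1 leq_add2l nleaves_gt0.
  by rewrite -add1n leq_add2r nleaves_gt0.
by rewrite finite_setU; split => //; exact: finite_image2.
Qed.

Fixpoint subtrees (t : btree) : seq btree :=
  match t with
  | Leaf => [:: Leaf]
  | Node u v => Node u v :: subtrees u ++ subtrees v
  end.

(* Trees are terms, so isomorphism of (ordered) subtrees is equality. *)
Definition dag_size (t : btree) : nat := size (undup (subtrees t)).

Section Sources.
Variable R : realType.
Implicit Types sigma : nat -> nat -> R.

(* The values of sigma with a zero argument are unconstrained and never used: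
   the domain of interest consists of the pairs of positive integers. *)
Definition is_source sigma : Prop :=
  (forall i j : nat, (1 <= i)%N -> (1 <= j)%N -> 0 <= sigma i j <= 1) /\
  (forall k : nat, (2 <= k)%N -> \sum_(1 <= i < k) sigma i (k - i)%N = 1).

Fixpoint P sigma (t : btree) : R :=
  match t with
  | Leaf => 1
  | Node u v => sigma (nleaves u) (nleaves v) * P sigma u * P sigma v
  end.

Definition avg_dag_size sigma (n : nat) : R :=
  \sum_(t \in trees n) P sigma t * (dag_size t)%:R.

End Sources.

(* Main.v *)
(* A 0/1-valued source gives positive probability to a single tree of each size,
   so the subtrees of that tree are determined by their sizes: at most [b] of
   them have at most [b] leaves. Since both children of a node with [m] leaves
   have at least [m / c] leaves, only O(n / b) nodes carry a subtree with more
   than [b] leaves. Taking for [b] the integer part of [sqrt n] gives the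
   bound. *)

Require Import Defs.
From mathcomp Require Import all_boot all_order all_algebra.
From mathcomp Require Import all_classical all_reals all_analysis.
From mathcomp Require Import zify lra.
Import Order.TTheory GRing.Theory Num.Theory.
Import numFieldNormedType.Exports.
Local Open Scope classical_set_scope.
Local Open Scope ring_scope.

(** The relation [r] is abstract so that the combinatorics stays free of probabilities. For
    [r := sure sigma] with a 0/1-valued source, this predicate singles out the trees of probability
    1. *)
Fixpoint all_splits (r : rel nat) (t : btree) : bool :=
  match t with
  | Leaf => true
  | Node u v =>
      [&& r (nleaves u) (nleaves v), all_splits r u & all_splits r v]
  end.

Lemma all_splits_subtrees (r : rel nat) (s t : btree) :
  all_splits r t -> s \in subtrees t -> all_splits r s.
Proof.
elim: t => [|u IHu v IHv] /=; first by rewrite inE => _ /eqP ->.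
move=> /and3P[ruv ru rv]; rewrite inE mem_cat => /orP[/eqP -> /=|].
  by rewrite ruv ru rv.
by case/orP; [exact: IHu | exact: IHv].
Qed.

Lemma all_splits_inj (r : rel nat)
    (rfun : forall i j i' j', (0 < i)%N -> (0 < j)%N -> (0 < i')%N ->
      (0 < j')%N -> (i + j = i' + j')%N -> r i j -> r i' j' -> i = i')
    (s t : btree) :
  all_splits r s -> all_splits r t -> nleaves s = nleaves t -> s = t.
Proof.
elim: s t => [|u IHu v IHv] [|u' v'] //=.
- by move: (nleaves_gt0 u') (nleaves_gt0 v'); lia.
- by move: (nleaves_gt0 u) (nleaves_gt0 v); lia.
move=> /and3P[ruv ru rv] /and3P[ruv' ru' rv'] E.
have Eu : nleaves u = nleaves u'.
  by apply: rfun E ruv ruv'; exact: nleaves_gt0.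
have Ev : nleaves v = nleaves v' by lia.
by congr Node; [exact: IHu | exact: IHv].
Qed.

(** Occurrences are counted with multiplicity, which makes the count additive over the two
    children. *)
Definition nbig (b : nat) (t : btree) : nat :=
  count (fun s => b < nleaves s)%N (subtrees t).

Lemma nbig_node (b : nat) (u v : btree) :
  nbig b (Node u v) =
  ((b < nleaves u + nleaves v) + (nbig b u + nbig b v))%N.
Proof. by rewrite /nbig /= count_cat. Qed.

Lemma nbig_small (b : nat) (t : btree) :
  (nleaves t <= b)%N -> nbig b t = 0%N.
Proof.
elim: t => [|u IHu v IHv] /=; first by rewrite /nbig /=; case: b.
by move=> h; rewrite nbig_node IHu ?IHv; lia.
Qed.

(* The additive slack [b] on the left pays for a node both of whose children
   are big. A big node with a single big child is paid for by the leaves of its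
   small child, of which there are at least [b / C]. *)
Lemma nbig_bound (r : rel nat) (C b : nat) (t : btree)
    (rbal : forall i j, (0 < i)%N -> (0 < j)%N -> r i j ->
      (i + j <= C * i)%N /\ (i + j <= C * j)%N) :
  all_splits r t -> (0 < b < nleaves t)%N ->
  (b * nbig b t + b <= (C + 2) * nleaves t)%N.
Proof.
elim: t => [|u IHu v IHv] /=; first by lia.
move=> /and3P[ruv ru rv] /andP[b0 bt]; rewrite nbig_node bt.
have [hu hv] := rbal _ _ (nleaves_gt0 u) (nleaves_gt0 v) ruv.
have [bu|bu] := leqP (nleaves u) b; have [bv|bv] := leqP (nleaves v) b.
(* Both children are small: the left side is [2 * b], covered by the summand 2 of [C + 2]. *)
- by rewrite !nbig_small //; lia.
- by move: (IHv rv); rewrite (nbig_small _ u) // b0 bv => /(_ isT); lia.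
- by move: (IHu ru); rewrite (nbig_small _ v) // b0 bu => /(_ isT); lia.
by move: (IHu ru) (IHv rv); rewrite b0 bu bv => /(_ isT) + /(_ isT); lia.
Qed.

(** Distinct subtrees with at most [b] leaves are mapped injectively into [1..b] by [nleaves]; the
    remaining ones are among the occurrences counted by [nbig]. *)
Lemma dag_size_le (b : nat) (t : btree) :
  {in subtrees t &, injective nleaves} -> (dag_size t <= b + nbig b t)%N.
Proof.
move=> inj; rewrite /dag_size; set D := undup _.
rewrite -(count_predC (fun s => nleaves s <= b)%N D) leq_add //.
  rewrite -size_filter -(size_map nleaves) -[leqRHS](size_iota 1).
  apply: uniq_leq_size.
    rewrite map_inj_in_uniq ?filter_uniq ?undup_uniq // => s s'.
    rewrite !mem_filter !mem_undup => /andP[_ sS] /andP[_ sS'].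
    exact: inj.
  move=> m /mapP[s]; rewrite mem_filter mem_iota => /andP[sb _] ->.
  by rewrite nleaves_gt0 add1n ltnS.
rewrite /nbig (eq_count (a2 := fun s => b < nleaves s)%N); last first.
  by move=> s /=; rewrite ltnNge.
by rewrite -!size_filter filter_undup size_undup.
Qed.

Lemma dag_size_bound (r : rel nat) (C b : nat) (t : btree)
    (rfun : forall i j i' j', (0 < i)%N -> (0 < j)%N -> (0 < i')%N ->
      (0 < j')%N -> (i + j = i' + j')%N -> r i j -> r i' j' -> i = i')
    (rbal : forall i j, (0 < i)%N -> (0 < j)%N -> r i j ->
      (i + j <= C * i)%N /\ (i + j <= C * j)%N) :
  all_splits r t -> (0 < b)%N ->
  (b * dag_size t <= b ^ 2 + (C + 2) * nleaves t)%N.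
Proof.
move=> rt b0.
have : (dag_size t <= b + nbig b t)%N.
  apply: dag_size_le => s s' sS sS'; apply: (all_splits_inj _ rfun).
    exact: all_splits_subtrees sS.
  exact: all_splits_subtrees sS'.
rewrite -(leq_pmul2l b0) mulnDr mulnn => /leq_trans; apply.
rewrite leq_add2l; have [tb|bt] := leqP (nleaves t) b.
  by rewrite nbig_small ?muln0.
apply: leq_trans (leq_addr b _) _.
by apply: (nbig_bound _ _ _ _ rbal rt); rewrite b0.
Qed.

Section DeterministicSource.
Variables (R : realType) (sigma : nat -> nat -> R).

Definition sure : rel nat := fun i j => sigma i j == 1.

Hypothesis hsigma : is_source sigma.

(** The nonnegative values on a diagonal sum to 1, so a value 1 at [i] forces all others to
    vanish. *)
Lemma sure_fun (i j i' j' : nat) : (0 < i)%N -> (0 < j)%N -> (0 < i')%N ->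
  (0 < j')%N -> (i + j = i' + j')%N -> sure i j -> sure i' j' -> i = i'.
Proof.
move=> i0 j0 i0' j0' E /eqP sij /eqP sij'; apply/eqP.
apply: contraT => ne; have [s01 /(_ (i + j)%N)] := hsigma.
rewrite (bigD1_seq i) ?iota_uniq //=; last by rewrite mem_index_iota; lia.
rewrite addKn sij => /(_ ltac:(lia)) /eqP.
rewrite -subr_eq0 addrAC subrr add0r.
rewrite big_seq_cond psumr_eq0; last first.
  move=> k; rewrite mem_index_iota => /andP[? _].
  by case/andP: (s01 k (i + j - k)%N ltac:(lia) ltac:(lia)).
move/allP => /(_ i'); rewrite mem_index_iota E addKn sij' oner_eq0 implybF.
by rewrite eq_sym ne andbT; lia.
Qed.

Hypothesis hdet : forall n i : nat, (2 <= n)%N -> (1 <= i <= n - 1)%N ->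
  sigma i (n - i)%N = 0 \/ sigma i (n - i)%N = 1.

Lemma sigma01 (i j : nat) : (0 < i)%N -> (0 < j)%N ->
  sigma i j = (sure i j)%:R.
Proof using hdet.
move=> i0 j0; rewrite /sure.
have := @hdet (i + j)%N i; rewrite addKn => -[||->|->]; try lia.
  by rewrite eq_sym oner_eq0.
by rewrite eqxx.
Qed.

Lemma P01 (t : btree) : P sigma t = (all_splits sure t)%:R.
Proof.
elim: t => [|u IHu v IHv] //=; rewrite IHu IHv.
by rewrite sigma01 ?nleaves_gt0 // -mulrA -!natrM !mulnb.
Qed.

Lemma sure_balanced (c : R) (hc : 3 <= c)
    (hbal : forall n : nat, (2 <= n)%N ->
      1 <= \sum_(k < n.+1 | n%:R / c <= k%:R <= n%:R - n%:R / c)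
             sigma k (n - k)%N)
    (i j : nat) : (0 < i)%N -> (0 < j)%N -> sure i j ->
  (i + j <= Num.bound c * i)%N /\ (i + j <= Num.bound c * j)%N.
Proof.
move=> i0 j0 sij; have c0 : 0 < c by exact: lt_le_trans hc.
have n0 : 0 < (i + j)%:R / c by rewrite divr_gt0 // ltr0n addn_gt0 i0.
have [k /andP[k1 k2] sk] : exists2 k : 'I_(i + j).+1,
    (i + j)%:R / c <= k%:R <= (i + j)%:R - (i + j)%:R / c
    & sigma k (i + j - k)%N != 0.
  apply/exists_inP; apply: contraT; rewrite negb_exists_in => /forall_inP z.
  have := hbal (i + j) ltac:(lia); rewrite big1 ?ler10 // => k /z.
  by rewrite negbK => /eqP.
(* The sum in [hbal] formally includes [k = 0] and [k = i + j], where [sigma] is unconstrained;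
   positivity of [(i + j) / c] rules them out. *)
have k0 : (0 < k)%N by rewrite -(ltr0n R); exact: lt_le_trans k1.
have kn : (k < i + j)%N by rewrite -(ltr_nat R); lra.
have Ek : k = i :> nat.
  apply: (@sure_fun k (i + j - k) i j) => //; try lia.
  by move: sk; rewrite sigma01 ?subn_gt0 //; case: (sure _ _); rewrite ?eqxx.
move: k1 k2; rewrite Ek natrD => k1 k2.
have cC : c < (Num.bound c)%:R by apply: archi_boundP; exact: ltW.
have bound (m : nat) : (i%:R + j%:R) / c <= m%:R ->
    (i + j <= Num.bound c * m)%N.
  rewrite ler_pdivrMr // => h; rewrite -(ler_nat R) natrD natrM mulrC.
  by apply: le_trans h _; rewrite ler_wpM2l // ltW.
by split; apply: bound => //; lra.
Qed.

(** The sum collapses to the single tree of probability 1, or to 0 if there is none; the latter case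
    uses [0 <= M]. *)
Lemma avg_dag_size_ge0_le (n : nat) (M : R) : 0 <= M ->
  (forall t, nleaves t = n -> all_splits sure t -> (dag_size t)%:R <= M) ->
  0 <= avg_dag_size sigma n <= M.
Proof.
move=> M0 hM; rewrite /avg_dag_size.
have [[t [tn st]]|none] :=
  pselect (exists t, nleaves t = n /\ all_splits sure t); last first.
  rewrite fsbig1 ?lexx // => t tn; rewrite P01.
  have [st|] := boolP (all_splits sure t); last by rewrite mul0r.
  by case: none; exists t.
rewrite -(@fsbig_widen _ _ _ _ [set t]); first last.
- move=> s [/= sn st']; rewrite P01.
  have [ss|] := boolP (all_splits sure s); last by rewrite mul0r.
  by case: st'; apply: (all_splits_inj _ sure_fun) => //; rewrite sn.
- by move=> s ->.
by rewrite fsbig_set1 P01 st mul1r ler0n hM.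
Qed.

End DeterministicSource.

Theorem theorem3p21 (R : realType) (c : R) (hc : 3 <= c)
  (sigma : nat -> nat -> R) (hsigma : is_source sigma)
  (hdet : forall n i : nat, (2 <= n)%N -> (1 <= i <= n - 1)%N ->
    sigma i (n - i)%N = 0 \/ sigma i (n - i)%N = 1)
  (hbal : forall n : nat, (2 <= n)%N ->
    1 <= \sum_(k < n.+1 | n%:R / c <= k%:R <= n%:R - n%:R / c)
           sigma k (n - k)%N) :
  (fun n : nat => avg_dag_size sigma n) =O_\oo
  (fun n : nat => Num.sqrt (n%:R : R)).
Proof.
set K : R := (Num.bound c + 2)%:R.
have K0 : 0 <= K by exact: ler0n.
(* With [b] the integer part of [s], the bound on [b * dag_size t] is [b ^ 2 + K * s ^ 2]. Here
   [b <= s], and [s < b + 1 <= 2 * b], so it is at most [(1 + 2 * K) * b * s]; then [b] is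
   cancelled. *)
apply/eqO_exP; exists (1 + 2 * K); first by lra.
(* From [1 <= n] it follows that [1 <= s], hence that [b] is positive. *)
exists 1%N => // n /= n1.
set s := Num.sqrt n%:R.
have s1 : 1 <= s by rewrite -[1](@sqrtr1 R) ler_sqrt // ler1n.
have ss : s ^+ 2 = n%:R by rewrite sqr_sqrtr.
rewrite (ger0_norm (x := s)); last by lra.
suff /andP[ge0 le] : 0 <= avg_dag_size sigma n <= (1 + 2 * K) * s.
  by rewrite ger0_norm.
apply: (avg_dag_size_ge0_le _ _ hsigma hdet) => [|t tn st]; first by rewrite mulr_ge0; lra.
have s0 : 0 <= s by lra.
have /andP[bs sb] := truncn_itv s0; set b := Num.trunc s in bs sb.
have b1 : (0 < b)%N by rewrite -ltnS -(ltr_nat R); exact: le_lt_trans sb.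
have := dag_size_bound _ (Num.bound c) b t (sure_fun _ _ hsigma)
  (sure_balanced _ _ hsigma hdet _ hc hbal) st b1.
rewrite tn -(ler_nat R) natrD !natrM -/K -ss => h.
move: b1 sb; rewrite -(ler1n R) -natr1 => b1 sb.
rewrite -(@ler_pM2l _ b%:R); last by lra.
have bbs : b%:R * b%:R <= b%:R * s by rewrite ler_wpM2l.
have Kss : K * (s * s) <= K * (2 * b%:R * s).
  by rewrite ler_wpM2l // ler_wpM2r //; lra.
by apply: le_trans h _; lra.
Qed.
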